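(* For $0<y<1$, $$\left(1+\sqrt{1-y}\right)^{-\frac12}=\sum_{m=0}^{\infty}\frac{(4m)!\,16^{-m}}{(2m)!\,(2m+1)!\,\sqrt{2}}\;y^{m}.$$
   Context: Here $\sqrt{\cdot}$ denotes the nonnegative real square root and $y$ is a real variable. *)

(* Defs.v *)
From Stdlib Require Export Reals Factorial.
From Coquelicot Require Export Coquelicot.

(* Main.v *)
(** Let [B s] be the binomial series of [sqrt (1 - s)]. The recurrence on its coefficients says
    [(1 - s) B' = - B / 2], so [B / sqrt (1 - s)] is constant on [(-1, 1)]. The coefficients of the
    theorem are, up to the factor [- sqrt 2], the odd coefficients of [B]; with [s = sqrt y] the sum is
    therefore [sqrt 2 (p - q) / (2 s)] where [p = sqrt (1 + s)] and [q = sqrt (1 - s)]. As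
    [p^2 - q^2 = 2 s] and [(p + q)^2 = 2 (1 + sqrt (1 - y))], this is [1 / sqrt (1 + sqrt (1 - y))]. *)
Require Import Defs.
From Stdlib Require Import Reals Factorial Lra Lia.
From Coquelicot Require Import Coquelicot.
Open Scope R_scope.

(** The value at [n] is (-1)^n binom(1/2, n): consecutive ones have ratio (k - 1/2) / (k + 1). *)
Fixpoint sqrt1m_coef (n : nat) : R :=
  match n with
  | O => 1
  | S k => sqrt1m_coef k * (INR k - 1 / 2) / INR (S k)
  end.

(** With C_n the Catalan number, this is - C_n / (2 * 4^n). The shifted index leaves out the
    constant term 1, which has the opposite sign. *)
Lemma sqrt1m_coef_closed (n : nat) :
  sqrt1m_coef (S n) =
  - INR (fact (2 * n)) / (2 * 4 ^ n * INR (fact n) * INR (fact (S n))).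
Proof.
induction n as [|n IH].
- simpl; field.
- change (sqrt1m_coef (S (S n)))
    with (sqrt1m_coef (S n) * (INR (S n) - 1 / 2) / INR (S (S n))).
  rewrite IH.
  replace (2 * S n)%nat with (S (S (2 * n))) by lia.
  rewrite !fact_simpl, !mult_INR, !S_INR, mult_INR; simpl (INR 2); simpl (4 ^ S n).
  assert (Hn := pos_INR n).
  assert (H1 := INR_fact_neq_0 n).
  assert (H2 : 4 ^ n <> 0) by (apply pow_nonzero; lra).
  field; repeat split; lra.
Qed.

(** Each ratio satisfies |k - 1/2| <= k + 1. This crude bound already gives convergence on (-1,
    1). *)
Lemma sqrt1m_coef_bound (n : nat) : Rabs (sqrt1m_coef n) <= 1.
Proof.
induction n as [|n IH].
- simpl; rewrite Rabs_R1; lra.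
- cbn [sqrt1m_coef]; unfold Rdiv; rewrite Rmult_assoc, Rabs_mult, S_INR.
  assert (Hn := pos_INR n).
  replace 1 with (1 * 1) at 3 by ring.
    apply Rmult_le_compat; try apply Rabs_pos; try exact IH.
  assert (Hi : 0 < / (INR n + 1)) by (apply Rinv_0_lt_compat; lra).
  rewrite Rabs_mult, (Rabs_pos_eq (/ (INR n + 1))) by lra.
  apply Rmult_le_reg_r with (INR n + 1); [lra|].
  rewrite Rmult_assoc, Rinv_l by lra.
  unfold Rabs; destruct Rcase_abs; lra.
Qed.

Lemma CV_radius_bounded_coef (a : nat -> R) (M : R) :
  (forall n, Rabs (a n) <= M) -> Rbar_le 1 (CV_radius a).
Proof.
intros Ha.
apply (proj1 (CV_radius_bounded a)).
exists M; intros n; rewrite pow1, Rmult_1_r; apply Ha.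
Qed.

Lemma ex_pseries_bounded_coef (a : nat -> R) (M x : R) :
  (forall n, Rabs (a n) <= M) -> Rabs x < 1 -> ex_pseries a x.
Proof.
intros Ha Hx; apply CV_radius_inside.
apply Rbar_lt_le_trans with (1 : Rbar); [exact Hx|].
exact (CV_radius_bounded_coef a M Ha).
Qed.

Lemma sqrt1m_series_derive (x : R) : Rabs x < 1 ->
  is_derive (PSeries sqrt1m_coef) x (- PSeries sqrt1m_coef x / (2 * (1 - x))).
Proof.
intros Hx.
assert (Hr : Rbar_lt (Rabs x) (CV_radius sqrt1m_coef)).
{ apply Rbar_lt_le_trans with (1 : Rbar); [exact Hx|].
  exact (CV_radius_bounded_coef _ 1 sqrt1m_coef_bound). }
(* Comparing coefficients of x^n, this is the recurrence (n + 1) a_(n+1) = n a_n - a_n / 2. *)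
assert (HD : PSeries (PS_derive sqrt1m_coef) x
  = x * PSeries (PS_derive sqrt1m_coef) x - / 2 * PSeries sqrt1m_coef x).
{ rewrite <- PSeries_incr_1, <- PSeries_scal, <- PSeries_minus.
  - apply PSeries_ext; intros n.
    unfold PS_derive, PS_minus, PS_plus, PS_opp, PS_scal, PS_incr_1,
      plus, opp, scal; simpl; unfold mult; simpl.
    destruct n as [|n].
    + simpl; unfold zero; simpl; field.
    + assert (Hn := pos_INR n).
      change (match n with O => 1 | S _ => INR n + 1 end) with (INR (S n)).
      change (sqrt1m_coef n * (INR n - 1 / 2) / INR (S n))
        with (sqrt1m_coef (S n)).
      rewrite !S_INR; field; lra.
  - apply ex_pseries_incr_1, CV_radius_inside.
    rewrite CV_radius_derive; exact Hr.
  - apply ex_pseries_scal; [apply Rmult_comm|].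
    apply CV_radius_inside; exact Hr. }
replace (- PSeries sqrt1m_coef x / (2 * (1 - x)))
  with (PSeries (PS_derive sqrt1m_coef) x).
- apply is_derive_PSeries; exact Hr.
- apply Rabs_def2 in Hx.
  apply Rmult_eq_reg_r with (2 * (1 - x)); [|lra].
  unfold Rdiv; rewrite Rmult_assoc, Rinv_l by lra; lra.
Qed.

Lemma sqrt1m_series (x : R) : Rabs x < 1 ->
  PSeries sqrt1m_coef x = sqrt (1 - x).
Proof.
intros Hx.
set (h := fun t => PSeries sqrt1m_coef t * / sqrt (1 - t)).
assert (Hh : forall t, Rabs t < 1 -> is_derive h t 0).
{ intros t Ht.
  assert (HB := sqrt1m_series_derive t Ht).
  apply Rabs_def2 in Ht.
  assert (Hs : 0 < sqrt (1 - t)) by (apply sqrt_lt_R0; lra).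
  assert (Hss : sqrt (1 - t) * sqrt (1 - t) = 1 - t) by (apply sqrt_sqrt; lra).
  assert (HS : is_derive (fun t => / sqrt (1 - t)) t
                 (/ (2 * sqrt (1 - t) * (1 - t)))).
  { auto_derive; replace (1 + - t) with (1 - t) by ring.
    - repeat split; lra.
    - rewrite Hss; field; lra. }
  assert (HM := is_derive_mult _ _ _ _ _ HB HS Rmult_comm).
  unfold mult, plus in HM; simpl in HM.
  (* The two terms of the product rule cancel. *)
  replace 0 with
    (- PSeries sqrt1m_coef t / (2 * (1 - t)) * / sqrt (1 - t) +
     PSeries sqrt1m_coef t * / (2 * sqrt (1 - t) * (1 - t)));
    [exact HM | field; lra]. }
assert (H0 : h 0 = 1).
{ unfold h; rewrite PSeries_0, Rminus_0_r, sqrt_1; simpl; field. }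
assert (H1 : h x = 1).
{ rewrite <- H0; apply Rabs_def2 in Hx.
  (* [eq_is_derive] wants the left endpoint first, so the sign of [x] decides the interval. *)
  destruct (Rtotal_order x 0) as [Hn | [-> | Hp]]; [| reflexivity |].
  - apply eq_is_derive; [|exact Hn].
    intros t Ht; apply Hh, Rabs_def1; lra.
  - symmetry; apply eq_is_derive; [|exact Hp].
    intros t Ht; apply Hh, Rabs_def1; lra. }
apply Rabs_def2 in Hx.
assert (Hs : 0 < sqrt (1 - x)) by (apply sqrt_lt_R0; lra).
unfold h in H1.
apply Rmult_eq_reg_r with (/ sqrt (1 - x)); [|apply Rinv_neq_0_compat; lra].
rewrite H1; field; lra.
Qed.

(** Split B(s) = E(s^2) + s O(s^2) into even and odd parts. Subtracting B(-s) = E(s^2) - s O(s^2)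
    isolates 2 s O(s^2). *)
Lemma sqrt1m_odd_series (s : R) : 0 < s < 1 ->
  is_pseries (fun n => sqrt1m_coef (2 * n + 1)) (s ^ 2)
    ((sqrt (1 - s) - sqrt (1 + s)) / (2 * s)).
Proof.
intros Hs.
assert (Hs2 : Rabs (s ^ 2) < 1) by (apply Rabs_def1; nra).
assert (Ee : ex_pseries (fun n => sqrt1m_coef (2 * n)) (s ^ 2)).
{ apply ex_pseries_bounded_coef with 1; [|exact Hs2].
  intros n; apply sqrt1m_coef_bound. }
assert (Eo : ex_pseries (fun n => sqrt1m_coef (2 * n + 1)) (s ^ 2)).
{ apply ex_pseries_bounded_coef with 1; [|exact Hs2].
  intros n; apply sqrt1m_coef_bound. }
assert (Hneg : (- s) ^ 2 = s ^ 2) by ring.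
assert (Hp := PSeries_odd_even sqrt1m_coef s Ee Eo).
assert (Hm := PSeries_odd_even sqrt1m_coef (- s)).
rewrite Hneg in Hm; specialize (Hm Ee Eo).
rewrite sqrt1m_series in Hp by (apply Rabs_def1; lra).
rewrite sqrt1m_series in Hm by (apply Rabs_def1; lra).
replace (1 - - s) with (1 + s) in Hm by ring.
rewrite Hp, Hm.
match goal with |- is_pseries _ _ ?v =>
  replace v with (PSeries (fun n => sqrt1m_coef (2 * n + 1)) (s ^ 2)) end.
- apply PSeries_correct; exact Eo.
- field; lra.
Qed.

Lemma Rpower_opp_half (x : R) : 0 < x -> Rpower x (- (1 / 2)) = / sqrt x.
Proof.
intros Hx; rewrite Rpower_Ropp.
replace (1 / 2) with (/ 2) by field.
rewrite Rpower_sqrt by exact Hx; reflexivity.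
Qed.

Theorem mainTheorem2 (y : R) (hy : 0 < y < 1) :
  is_series
    (fun m : nat =>
       (INR (fact (4 * m)%nat) * / 16 ^ m)
         / (INR (fact (2 * m)%nat) * INR (fact (2 * m + 1)%nat) * sqrt 2) * y ^ m)
    (Rpower (1 + sqrt (1 - y)) (- (1 / 2))).
Proof.
set (s := sqrt y).
assert (Hs2 : s ^ 2 = y) by (apply pow2_sqrt; lra).
assert (Hs0 : 0 < s) by (apply sqrt_lt_R0; lra).
assert (Hs1 : s < 1) by nra.
assert (Hr2 : 0 < sqrt 2) by (apply sqrt_lt_R0; lra).
assert (Hr22 : sqrt 2 * sqrt 2 = 2) by (apply sqrt_sqrt; lra).
assert (Hw : 0 <= sqrt (1 - y)) by apply sqrt_pos.
assert (Hv : Rpower (1 + sqrt (1 - y)) (- (1 / 2)) =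
  - sqrt 2 * ((sqrt (1 - s) - sqrt (1 + s)) / (2 * s))).
{ rewrite Rpower_opp_half by lra.
  set (q := sqrt (1 - s)); set (p := sqrt (1 + s)).
  assert (Hq : 0 < q) by (apply sqrt_lt_R0; lra).
  assert (Hp : 0 < p) by (apply sqrt_lt_R0; lra).
  assert (Hqq : q * q = 1 - s) by (apply sqrt_sqrt; lra).
  assert (Hpp : p * p = 1 + s) by (apply sqrt_sqrt; lra).
  assert (Hpq : sqrt (1 - y) = p * q).
  { unfold p, q; rewrite <- sqrt_mult by lra; f_equal; lra. }
  (* Since p^2 + q^2 = 2, the square of p + q is 2 (1 + p q). *)
  assert (Hsq : sqrt (1 + p * q) = (p + q) / sqrt 2).
  { apply sqrt_lem_1.
    - nra.
    - apply Rlt_le, Rdiv_lt_0_compat; lra.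
    - replace ((p + q) / sqrt 2 * ((p + q) / sqrt 2))
        with ((p * p + q * q + 2 * (p * q)) / (sqrt 2 * sqrt 2)) by (field; lra).
      rewrite Hpp, Hqq, Hr22; field. }
  rewrite Hpq, Hsq.
  replace (2 * s) with ((p - q) * (p + q)) by lra.
  (* The product (p - q)(p + q) = 2 s is positive. *)
  assert (Hd : p - q <> 0) by nra.
  field; repeat split; lra. }
rewrite Hv.
assert (H := is_series_scal (- sqrt 2) _ _
  (proj1 (is_pseries_R _ _ _) (sqrt1m_odd_series s (conj Hs0 Hs1)))).
rewrite Hs2 in H.
refine (is_series_ext _ _ _ _ H).
intros m; unfold scal; simpl; unfold mult; simpl.
(* The closed form is used at n = 2 m, which produces (4m)! and 4^(2m) = 16^m. *)
replace (m + (m + 0) + 1)%nat with (S (2 * m)) by lia.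
rewrite sqrt1m_coef_closed.
replace (2 * (2 * m))%nat with (4 * m)%nat by lia.
rewrite (pow_mult 4 2 m).
replace (4 ^ 2) with 16 by ring.
replace (m + (m + (m + (m + 0))))%nat with (4 * m)%nat by lia.
replace (m + (m + 0))%nat with (2 * m)%nat by lia.
assert (H1 := INR_fact_neq_0 (2 * m)).
assert (H2 := INR_fact_neq_0 (S (2 * m))).
assert (H3 : 16 ^ m <> 0) by (apply pow_nonzero; lra).
(* [field] does not know [sqrt 2 * sqrt 2 = 2]. *)
replace (2 * 16 ^ m) with (sqrt 2 * sqrt 2 * 16 ^ m) by (rewrite Hr22; reflexivity).
field; repeat split; lra.
Qed.
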